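(* Let $P$ be a program calling a library $L$ whose code is missing, where library functions contain no allocations, no field is accessed by both $P$ and $L$, and there are no callbacks. Consider the naive points-to analysis: start with $\Pi_{\text{miss}}=\emptyset$; monitor every statement of $P$ of the form $x\gets *$; after each execution $e_i$, add to $\Pi_{\text{miss}}$ all counterexamples reported by the monitors during $e_i$; and let $\Pi_i$ be the set of static points-to edges computed from the resulting $\Pi_{\text{miss}}$. Then this analysis is (i) eventually sound, (ii) precise, and (iii) automatic, i.e. the static analysis requires no human input.
   Context: Programs. The available program $P$ is a finite set of statements over a finite set $\mathcal{V}_P$ of program (visible) variables: allocations $x\gets X()$ ($X$ a class), assignments $x\gets y$, loads $x\gets y.f$, stores $x.f\gets y$ ($f$ a field), and library calls $x\gets m(y)$, where $m\in\mathcal{M}$ is a function of the library $L$ (each has exactly one parameter $p_m$ and a return value $r_m$). $P$ contains no functions of its own. Control flow is not modelled: an execution runs some finite sequence of statements of $P$, starting with all variables null. Library functions are implemented by statements of the same kinds over their own variables (disjoint from $\mathcal{V}_P$). A call $x\gets m(y)$ assigns $y$ to $p_m$, runs the body of $m$, and then assigns $r_m$ to $x$. Standing assumptions: library functions contain no allocation statements; disjoint fields, i.e. no field is accessed both by a load or store of $P$ and by a load or store of the library; no callbacks from the library into $P$. Objects. An abstract object $o\in\mathcal{O}$ is an allocation statement $o=(x\gets X())$ of $P$. Each time it is executed it creates a fresh concrete object $\bar o$, said to be allocated at $o$ (written $\bar o\leadsto o$). The dynamic points-to edge $x\hookrightarrow o$ ($x\in\mathcal{V}_P$) occurs in an execution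 if at some point $x$ points to a concrete object allocated at $o$. Static analysis. Given $\Pi_{\text{miss}}\subseteq\mathcal{V}_P\times\mathcal{O}$, the computed set $\Pi\subseteq\mathcal{V}_P\times\mathcal{O}$ is the least set such that: (1) if $o=(x\gets X())$ is in $P$ then $x\hookrightarrow o\in\Pi$; (2) if $x\gets y$ is in $P$ and $y\hookrightarrow o\in\Pi$ then $x\hookrightarrow o\in\Pi$; (3) if $x\gets y.f$ and $z.f\gets w$ are in $P$ and $y\hookrightarrow o',z\hookrightarrow o',w\hookrightarrow o\in\Pi$ then $x\hookrightarrow o\in\Pi$; (4) $\Pi_{\text{miss}}\subseteq\Pi$. Library calls are treated as no-ops. Monitoring. A monitor on a statement $x\gets *$ of $P$ records, each time the statement is executed, the pair $(x\gets *,\bar o)$, where $\bar o$ is the concrete object $x$ points to afterwards. A recorded pair $(x\gets X(),\bar o)$ reveals $\bar o\leadsto o=(x\gets X())$. For every recorded pair $(x\gets *,\bar o)$ with $\bar o\leadsto o$ revealed in the same execution, the edge $x\hookrightarrow o$ is detected; if it is not in the current $\Pi$ (the set computed before that execution), it is reported as a counterexample. Soundness notions. A points-to set $\Pi$ is sound relative to an execution $e$ if every dynamic points-to edge occurring in $e$ lies in $\Pi$. An analysis that for a sequence of executions $E=e_1,e_2,\dots$ (of $P$ with the fixed library) produces points-to sets $\Pi_1,\Pi_2,\dots$ ($\Pi_i$ computed from $\Pi_{i-1}$ and the counterexamples from $e_i$) is eventually sound if for every $E$: each $\Pi_i$ is sound relative to $e_1,\dots,e_i$, and there is $N\in\mathbb{N}$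 such that the sequence $\Pi_1,\Pi_2,\dots$ has at most $N$ distinct elements. It is precise if for every $E$ and $i$, $\Pi_i$ is a subset of the points-to set computed by analyzing also the implementation of the missing code, i.e. the set obtained by applying rules (1)–(3) to the statements of $P$ and of the library together, with each call $x\gets m(y)$ (in $P$ or in the library) replaced by the assignments $p_m\gets y$ and $x\gets r_m$. *)

(* Defs.v *)
From Stdlib Require List.
From mathcomp Require Import all_boot.
From mathcomp Require Import boolp classical_sets functions cardinality.

Set Implicit Arguments.
Unset Strict Implicit.
Unset Printing Implicit Defensive.

Local Open Scope classical_set_scope.

Section Syntax.

(* Variables (of the program and of the library), fields, classes, names of
   library functions. *)
Variables (V F : eqType) (C M : Type).

Inductive stmt : Type :=
| SAlloc of V & C            (* x <- X()   *)
| SAssign of V & V           (* x <- y     *)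
| SLoad of V & V & F         (* x <- y.f   *)
| SStore of V & F & V        (* x.f <- y   *)
| SCall of V & M & V.        (* x <- m(y)  *)

(* The abstract object [(x, X)] stands for the statement [SAlloc x X]. *)
Definition obj : Type := (V * C)%type.

(* The points-to edge [(x, o)]. *)
Definition edge : Type := (V * obj)%type.

Definition stmt_vars (st : stmt) : set V :=
  match st with
  | SAlloc x _ => [set x]
  | SAssign x y | SLoad x y _ | SStore x _ y | SCall x _ y => [set x; y]
  end.

Definition stmt_fields (st : stmt) : set F :=
  match st with
  | SLoad _ _ f | SStore _ f _ => [set f]
  | _ => set0
  end.

(* [Some x] exactly on the statements of the form x <- *; a store is not of
   this form. *)
Definition target (st : stmt) : option V :=
  match st with
  | SAlloc x _ | SAssign x _ | SLoad x _ _ | SCall x _ _ => Some x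
  | SStore _ _ _ => None
  end.

Definition is_alloc (st : stmt) : bool := if st is SAlloc _ _ then true else false.
Definition is_call (st : stmt) : bool := if st is SCall _ _ _ then true else false.

(* Calls can only name library functions, so callbacks into the program are
   excluded by the syntax; calls between library functions are allowed. *)
Record library : Type := Library {
  param : M -> V;
  ret : M -> V;
  body : M -> set stmt
}.

Definition library_stmts (L : library) : set stmt := \bigcup_m body L m.

Definition program_over (VP : set V) (P : set stmt) : Prop :=
  forall st, P st -> stmt_vars st `<=` VP.

Definition library_apart (VP : set V) (L : library) : Prop :=
  (forall m, ~ VP (param L m) /\ ~ VP (ret L m)) /\
  (forall st, library_stmts L st -> stmt_vars st `<=` ~` VP).

Definition no_library_alloc (L : library) : Prop :=
  forall st, library_stmts L st -> ~~ is_alloc st.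

Definition disjoint_fields (P : set stmt) (L : library) : Prop :=
  forall st st', P st -> library_stmts L st' ->
    stmt_fields st `&` stmt_fields st' = set0.

End Syntax.

Arguments SAlloc {V F C M}.
Arguments SAssign {V F C M}.
Arguments SLoad {V F C M}.
Arguments SStore {V F C M}.
Arguments SCall {V F C M}.

Section Semantics.

Variables (V F : eqType) (C M : Type).
Notation stmt := (stmt V F C M).
Notation obj := (obj V C).
Notation edge := (edge V C).
Notation library := (library V F C M).

(* Concrete objects are numbered by [nat], [None] is null.  The ghost
   component [site] gives the abstract object at which a concrete object was
   allocated, and is [None] as long as the object does not exist. *)
Record state : Type := State {
  env : V -> option nat;
  heap : nat -> F -> option nat;
  site : nat -> option obj
}.

Definition init : state :=
  State (fun=> None) (fun _ _ => None) (fun=> None).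

Definition set_var (s : state) (x : V) (v : option nat) : state :=
  State (fun y => if y == x then v else env s y) (heap s) (site s).

Definition set_field (s : state) (c : nat) (f : F) (v : option nat) : state :=
  State (env s)
    (fun d g => if (d == c) && (g == f) then v else heap s d g) (site s).

Definition new_object (s : state) (c : nat) (o : obj) : state :=
  State (env s)
    (fun d g => if d == c then None else heap s d g)
    (fun d => if d == c then Some o else site s d).

(* Control flow is abstracted away in library functions as well: running a
   body means running any finite sequence of its statements.  There is no rule
   for dereferencing null, so an execution ends before such a statement, and
   before a call during which it would happen. *)
Inductive step (L : library) : state -> stmt -> state -> Prop :=
| step_alloc s x X c :
    site s c = None ->
    step L s (SAlloc x X) (set_var (new_object s c (x, X)) x (Some c))
| step_assign s x y :
    step L s (SAssign x y) (set_var s x (env s y))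
| step_load s x y f c :
    env s y = Some c ->
    step L s (SLoad x y f) (set_var s x (heap s c f))
| step_store s x f y c :
    env s x = Some c ->
    step L s (SStore x f y) (set_field s c f (env s y))
| step_call s x m y s' :
    steps L (body L m) (set_var s (param L m) (env s y)) s' ->
    step L s (SCall x m y) (set_var s' x (env s' (ret L m)))
with steps (L : library) : set stmt -> state -> state -> Prop :=
| steps_nil B s : steps L B s s
| steps_cons (B : set stmt) st s s' s'' :
    B st -> step L s st s' -> steps L B s' s'' -> steps L B s s''.

(* The trace of an execution: the statements of the program that were run,
   each with the state reached after it.  States inside a library call are not
   listed: program variables and allocation sites do not change there before
   the result is assigned. *)
Definition trace : Type := seq (stmt * state).

Fixpoint runs_from (P : set stmt) (L : library) (s : state) (e : trace) : Prop :=
  if e is (st, s') :: e' then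
    [/\ P st, step L s st s' & runs_from P L s' e']
  else True.

Definition execution (P : set stmt) (L : library) (e : trace) : Prop :=
  runs_from P L init e.

(* Dynamic points-to edges; no edge occurs in the all-null initial state. *)
Definition occurs (VP : set V) (e : trace) : set edge :=
  [set p | VP p.1 /\ exists st s c,
     [/\ List.In (st, s) e, env s p.1 = Some c & site s c = Some p.2]].

Definition sound (VP : set V) (Pi : set edge) (e : trace) : Prop :=
  occurs VP e `<=` Pi.

Inductive points_to (S : set stmt) (miss : set edge) : edge -> Prop :=
| pt_alloc x X : S (SAlloc x X) -> points_to S miss (x, (x, X))
| pt_assign x y o :
    S (SAssign x y) -> points_to S miss (y, o) -> points_to S miss (x, o)
| pt_field x y z w f o o' :
    S (SLoad x y f) -> S (SStore z f w) ->
    points_to S miss (y, o') -> points_to S miss (z, o') ->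
    points_to S miss (w, o) -> points_to S miss (x, o)
| pt_miss p : miss p -> points_to S miss p.

Definition inline_calls (L : library) (S : set stmt) : set stmt :=
  [set st | (S st /\ ~~ is_call st) \/
            exists x m y, S (SCall x m y) /\
              (st = SAssign (param L m) y \/ st = SAssign x (ret L m))].

Definition full_points_to (P : set stmt) (L : library) : set edge :=
  points_to (inline_calls L (P `|` library_stmts L)) set0.

(* The pairs recorded during [e] by monitors on the statements in [mon];
   nothing is recorded when the assigned variable is null afterwards. *)
Definition recorded (mon : set stmt) (e : trace) : set (stmt * nat) :=
  [set r | mon r.1 /\ exists s x,
     [/\ List.In (r.1, s) e, target r.1 = Some x & env s x = Some r.2]].

Definition revealed (mon : set stmt) (e : trace) (c : nat) : set obj :=
  [set o | recorded mon e (SAlloc o.1 o.2, c)].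

Definition detected (mon : set stmt) (e : trace) : set edge :=
  [set p | exists st c,
     [/\ recorded mon e (st, c), target st = Some p.1 & revealed mon e c p.2]].

Definition counterexamples (mon : set stmt) (Pi : set edge) (e : trace) :
  set edge := detected mon e `\` Pi.

(* An analysis of a program, possibly interactive: the update of the set of
   missing edges receives the current set, the reported counterexamples, and
   the human input (of type [H]) given in this round. *)
Record analysis (H : Type) : Type := Analysis {
  monitors : set stmt;
  start : set edge;
  update : set edge -> set edge -> H -> set edge
}.

(* [E i] is the i-th execution and [h i] the i-th human input, for i >= 1;
   [E 0] and [h 0] are not used. *)
Fixpoint missing (H : Type) (P : set stmt) (A : analysis H)
    (h : nat -> H) (E : nat -> trace) (i : nat) : set edge :=
  if i is j.+1 then
    let miss := missing P A h E j in
    update A miss (counterexamples (monitors A) (points_to P miss) (E i)) (h i)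
  else start A.

Definition result (H : Type) (P : set stmt) (A : analysis H)
    (h : nat -> H) (E : nat -> trace) (i : nat) : set edge :=
  points_to P (missing P A h E i).

Definition naive (H : Type) (P : set stmt) : analysis H :=
  {| monitors := [set st | P st /\ target st != None];
     start := set0;
     update := fun miss cex _ => miss `|` cex |}.

Definition eventually_sound (VP : set V) (P : set stmt) (L : library)
    (Pi : (nat -> trace) -> nat -> set edge) : Prop :=
  forall E : nat -> trace, (forall i, 0 < i -> execution P L (E i)) ->
    (forall i j, 0 < j <= i -> sound VP (Pi E i) (E j)) /\
    (exists N, (Pi E @` [set i | 0 < i]%N #<= `I_N)%card).

Definition precise (P : set stmt) (L : library)
    (Pi : (nat -> trace) -> nat -> set edge) : Prop :=
  forall E : nat -> trace, (forall i, 0 < i -> execution P L (E i)) ->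
    forall i, 0 < i -> Pi E i `<=` full_points_to P L.

(* The points-to sets do not depend on what the human answers. *)
Definition automatic (H : Type) (P : set stmt) (A : analysis H) : Prop :=
  forall (h h' : nat -> H) (E : nat -> trace) i, 0 < i ->
    result P A h E i = result P A h' E i.

End Semantics.

(* Main.v *)
Require Import Defs.
From mathcomp Require Import all_boot.
From mathcomp Require Import boolp classical_sets functions cardinality.

(** Soundness: library code changes neither program variables nor allocation
    sites, so whenever a program variable points to an object, monitored
    statements of the same run have recorded both the assignment and the
    allocation; the edge is thus detected.  Precision: the rules (1)-(3) for
    the inlined code give an invariant of all reachable states, so every
    detected edge lies in the full points-to set.  The sets [Pi_i] consist of
    edges between program variables and allocations of [P], a finite set with
    finitely many subsets. *)

Set Implicit Arguments.
Unset Strict Implicit.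
Unset Printing Implicit Defensive.

Local Open Scope classical_set_scope.

(** With [A] listed as [s], every subset is the image under [g] of a set of indices, and there are
    finitely many of those. *)
Lemma finite_powerset (T : Type) (A : set T) :
  finite_set A -> finite_set [set B : set T | B `<=` A].
Proof.
elim/Pchoice: T => T in A *.
move=> /finite_seqP[s ->].
pose t := in_tuple s.
pose g (J : {set 'I_(size s)}) : set T := [set x | exists2 i, i \in J & x = tnth t i].
apply: (@sub_finite_set _ _ (range g)); last exact/finite_image/finite_finset.
move=> B sB; exists [set i | `[< B (tnth t i) >]]%SET => //.
apply/seteqP; split=> x.
  by move=> [i]; rewrite inE => /asboolP Bi ->.
move=> Bx; have /tnthP[i xi] : x \in t by exact: sB.
by exists i => //; rewrite inE; apply/asboolP; rewrite -xi.
Qed.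

Scheme step_mutind := Minimality for step Sort Prop
  with steps_mutind := Minimality for steps Sort Prop.
Combined Scheme step_steps_ind from step_mutind, steps_mutind.

Section NaiveAnalysis.

Variables (V F : eqType) (C M : Type).
Notation stmt := (stmt V F C M).
Notation obj := (obj V C).
Notation edge := (edge V C).
Notation state := (state V F C).
Notation trace := (trace V F C M).

Variables (VP : set V) (P : set stmt) (L : library V F C M).

(** * Static points-to rules *)

(** No rule matches a call, so calls of [S] may be dropped. This serves both for growing missing
    sets over [P] and for the passage to inlined code. *)
Lemma points_toS (S S' : set stmt) (miss miss' : set edge) :
  (forall st, S st -> ~~ is_call st -> S' st) ->
  miss `<=` points_to S' miss' -> points_to S miss `<=` points_to S' miss'.
Proof.
move=> SS' missS p; elim=> {p}.
- by move=> x X Sst; apply: pt_alloc; apply: SS'.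
- by move=> x y o Sst _; apply: pt_assign; apply: SS'.
- move=> x y z w f o o' Sl Ss _ IHy _ IHz _.
  exact: (pt_field (SS' _ Sl isT) (SS' _ Ss isT) IHy IHz).
- by move=> p /missS.
Qed.

(** Rules (2) and (3) only move known objects to targets in [P]; this confines all results to one
    finite set. *)
Lemma points_to_range (miss : set edge) :
  program_over VP P ->
  miss `<=` VP `*` [set o | P (SAlloc o.1 o.2)] ->
  points_to P miss `<=` VP `*` [set o | P (SAlloc o.1 o.2)].
Proof.
move=> overP missR p; elim=> {p}.
- by move=> x X Pst; split=> //=; apply: (overP _ Pst).
- by move=> x y o Pst _ [/= _ Po]; split=> //=; apply: (overP _ Pst); left.
- move=> x y z w f o o' Pl _ _ _ _ _ _ [/= _ Po]; split=> //=.
  by apply: (overP _ Pl); left.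
- by move=> p /missR.
Qed.

(** * Effect of steps on variables and allocation sites *)

Lemma step_site_mono :
  (forall s st t, step L s st t ->
     forall c o, site s c = Some o -> site t c = Some o) /\
  (forall (B : set stmt) s t, steps L B s t ->
     forall c o, site s c = Some o -> site t c = Some o).
Proof.
apply: (@step_steps_ind _ _ _ _ L) => //=; last by auto.
by move=> s x X c sc d o; case: eqP => [->|//]; rewrite sc.
Qed.

(** A nested call also writes the parameter of its callee, which lies outside [VP], and runs a body
    that is again library code; hence the joint induction. *)
Lemma library_frame :
  library_apart VP L -> no_library_alloc L ->
  (forall s st t, step L s st t -> library_stmts L st ->
     site t = site s /\ forall x, VP x -> env t x = env s x) /\
  (forall (B : set stmt) s t, steps L B s t -> B `<=` library_stmts L ->
     site t = site s /\ forall x, VP x -> env t x = env s x).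
Proof.
move=> [apartPR apartS] noalloc.
have fresh st x y : library_stmts L st -> target st = Some x -> VP y -> y != x.
  move=> Lst stx VPy; apply/eqP => yx.
  apply: (apartS _ Lst x); last by rewrite -yx.
  by case: st stx {Lst} => //= [? ?|? ?|? ? ?|? ? ?] [->] //; left.
apply: (@step_steps_ind _ _ _ _ L) => /=.
- by move=> s x X c _ /noalloc.
- move=> s x y Lst; split=> // z VPz.
  by rewrite (negPf (fresh _ x _ Lst _ VPz)).
- move=> s x y f c _ Lst; split=> // z VPz.
  by rewrite (negPf (fresh _ x _ Lst _ VPz)).
- by [].
- move=> s x m y s' _ IH Lst.
  have [|-> eE] := IH; first by move=> st ?; exists m.
  split=> // z VPz; rewrite (negPf (fresh _ x _ Lst _ VPz)) // eE //=.
  by case: eqP => // zp; case: (apartPR m) => []; rewrite -zp.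
- by [].
- move=> B st s s' s'' Bst _ IH1 _ IH2 BL.
  have [s1 e1] := IH1 (BL _ Bst); have [s2 e2] := IH2 BL.
  by split=> [|x VPx]; rewrite ?s2 // e2 // e1.
Qed.

Lemma step_env s st t x :
  library_apart VP L -> no_library_alloc L ->
  step L s st t -> VP x -> target st = Some x \/ env t x = env s x.
Proof.
move=> apart noalloc sst VPx.
case: sst => {s st t} /= [s y|s y|s y|s y|s y m z s' st] *.
- by case: eqP => [->|]; [left|right].
- by case: eqP => [->|]; [left|right].
- by case: eqP => [->|]; [left|right].
- by right.
- case: eqP => [->|_]; [by left|right].
  have [_ /(_ _ _ _ st)[]] := library_frame apart noalloc.
    by move=> st' ?; exists m.
  move=> _ ->//=; case: eqP => // xp.
  by have [/(_ m)[]] := apart; rewrite -xp.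
Qed.

Lemma step_site s st t c o :
  library_apart VP L -> no_library_alloc L ->
  step L s st t -> site t c = Some o ->
  site s c = Some o \/ st = SAlloc o.1 o.2 /\ env t o.1 = Some c.
Proof.
move=> apart noalloc sst.
case: sst => {s st t} /= [s y X d _|s y|s y|s y|s y m z s' st]; try by left.
  by case: eqP => [->|_]; [move=> [<-] /=; rewrite eqxx; right|left].
have [_ /(_ _ _ _ st)[]] := library_frame apart noalloc.
  by move=> st' ?; exists m.
by move=> /= -> _; left.
Qed.

(** * From dynamic edges to recorded pairs *)

(** The start state is general for the induction; from [init], where all variables are null, only
    the second alternative survives. *)
Lemma run_assigned s e st t x c :
  library_apart VP L -> no_library_alloc L ->
  runs_from P L s e -> List.In (st, t) e -> VP x -> env t x = Some c ->
  env s x = Some c \/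
  exists st' t', [/\ List.In (st', t') e, target st' = Some x & env t' x = Some c].
Proof.
move=> apart noalloc + + VPx tx.
elim: e s => //= -[st1 s1] e IH s [_ ss1 run] tin.
have : env s1 x = Some c \/ exists st' t',
    [/\ List.In (st', t') e, target st' = Some x & env t' x = Some c].
  by case: tin => [[_ ->]|tin]; [left|exact: IH run tin].
case=> [s1x|[st' [t' [? ? ?]]]]; last by right; exists st', t'; split=> //; right.
have [st1x|<-] := step_env apart noalloc ss1 VPx; last by left.
by right; exists st1, s1; split=> //; left.
Qed.

Lemma run_allocated s e st t c o :
  library_apart VP L -> no_library_alloc L ->
  runs_from P L s e -> List.In (st, t) e -> site t c = Some o ->
  site s c = Some o \/
  exists t', List.In (SAlloc o.1 o.2, t') e /\ env t' o.1 = Some c.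
Proof.
move=> apart noalloc + + tc.
elim: e s => //= -[st1 s1] e IH s [_ ss1 run] tin.
have : site s1 c = Some o \/
    exists t', List.In (SAlloc o.1 o.2, t') e /\ env t' o.1 = Some c.
  by case: tin => [[_ ->]|tin]; [left|exact: IH run tin].
case=> [s1c|[t' [? ?]]]; last by right; exists t'; split=> //; right.
have [|[<- ?]] := step_site apart noalloc ss1 s1c; first by left.
by right; exists s1; split=> //; left.
Qed.

Lemma run_stmt s e st t : runs_from P L s e -> List.In (st, t) e -> P st.
Proof.
elim: e s => //= -[st1 s1] e IH s [Pst _ run] [[<- _] //|]; exact: IH run.
Qed.

Lemma sound_detected e :
  library_apart VP L -> no_library_alloc L -> execution P L e ->
  occurs VP e `<=` detected [set st | P st /\ target st != None] e.
Proof.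
move=> apart noalloc run [x o] [/= VPx [st [t [c [tin tx tc]]]]].
have [//|[st' [t' [t'in st'x t'x]]]] := run_assigned apart noalloc run tin VPx tx.
have [//|[u [uin uo]]] := run_allocated apart noalloc run tin tc.
exists st', c; split=> //=; split=> /=.
- by split; [exact: run_stmt run t'in|rewrite st'x].
- by exists t', x.
- by split=> //; exact: run_stmt run uin.
- by exists u, o.1.
Qed.

Lemma detected_range e :
  program_over VP P -> detected [set st | P st /\ target st != None] e `<=`
    VP `*` [set o | P (SAlloc o.1 o.2)].
Proof.
move=> overP [x o] [st [c [[/= [Pst _] _] /= stx [/= [Po _] _]]]]; split=> //=.
apply: (overP _ Pst).
by case: st stx {Pst} => //= [? ?|? ?|? ? ?|? ? ?] [->] //; left.
Qed.

(** * Invariant for precision *)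

(** Library variables are included. For each non-null heap cell a store that may have filled it is
    kept: the store premises of rule (3), ready for a later load. *)
Definition points_to_inv (Pi : set edge) (s : state) : Prop :=
  (forall x c, env s x = Some c ->
     exists2 o, site s c = Some o & Pi (x, o)) /\
  (forall c f d, heap s c f = Some d ->
     exists o o' z w, [/\ site s c = Some o', site s d = Some o,
       (P `|` library_stmts L) (SStore z f w), Pi (z, o') & Pi (w, o)]).

Lemma points_to_inv_set_var Pi s x v : points_to_inv Pi s ->
  (forall c, v = Some c -> exists2 o, site s c = Some o & Pi (x, o)) ->
  points_to_inv Pi (set_var s x v).
Proof.
by move=> [eI hI] vI; split=> //= y c; case: eqP => [-> /vI|_ /eI].
Qed.

Lemma points_to_inv_assign s x y :
  inline_calls L (P `|` library_stmts L) (SAssign x y) ->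
  points_to_inv (full_points_to P L) s ->
  points_to_inv (full_points_to P L) (set_var s x (env s y)).
Proof.
move=> Sst sI; apply: points_to_inv_set_var => // c /sI.1[o sc yo].
by exists o => //; apply: pt_assign yo.
Qed.

Lemma step_points_to_inv :
  (forall s st t, step L s st t -> (P `|` library_stmts L) st ->
     points_to_inv (full_points_to P L) s ->
     points_to_inv (full_points_to P L) t) /\
  (forall (B : set stmt) s t, steps L B s t -> B `<=` P `|` library_stmts L ->
     points_to_inv (full_points_to P L) s ->
     points_to_inv (full_points_to P L) t).
Proof.
apply: (@step_steps_ind _ _ _ _ L) => /=.
- move=> s x X c sc Sst [eI hI]; apply: points_to_inv_set_var; last first.
    move=> _ [<-] /=; rewrite eqxx; exists (x, X) => //.
    by apply: pt_alloc; left.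
  (* The fresh [c] has no site, so objects with a site differ from it and keep theirs. *)
  have live d o : site s d = Some o -> (d == c) = false.
    by case: eqP => // ->; rewrite sc.
  split=> [y d /eI[o sd yo]|d f d'] /=; first by exists o; rewrite ?(live _ o).
  case: eqP => // _ /hI[o [o' [z [w [sd sd' ? ? ?]]]]].
  by exists o, o', z, w; rewrite (live _ _ sd').
- by move=> s x y Sst; apply: points_to_inv_assign; left.
- move=> s x y f c yc Sl sI; apply: points_to_inv_set_var => // d.
  move=> /sI.2[o [o' [z [w [sc sd Ss zo' wo]]]]]; exists o => //.
  (* The site of [c] is known from its heap cell and from [y]; equating both gives the common object
     [o'] of rule (3). *)
  have [o1 sc1 yo1] := sI.1 _ _ yc; move: sc1 yo1; rewrite sc => -[<-] yo'.
  by apply: (@pt_field _ _ _ _ _ _ x y z w f o o') => //; left.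
- move=> s x f y c xc Ss [eI hI]; split=> //= d g d'.
  case: ifP => [/andP[/eqP-> /eqP->] yd'|_ /hI//].
  have [o' ? ?] := eI _ _ xc; have [o ? ?] := eI _ _ yd'.
  by exists o, o', x, y.
- move=> s x m y s' _ IH Sc sI.
  (* Backwards, a call is the assignment from [ret L m], the body, and the assignment to
     [param L m]; inlining provides both assignments. *)
  apply: points_to_inv_assign; first by right; exists x, m, y; split=> //; right.
  apply: IH; first by move=> st Bst; right; exists m.
  by apply: points_to_inv_assign => //; right; exists x, m, y; split=> //; left.
- by [].
- by move=> B st s s' s'' Bst _ IH1 _ IH2 BS /(IH1 (BS _ Bst)) /(IH2 BS).
Qed.

Lemma alloc_site s st t o c :
  step L s st t -> st = SAlloc o.1 o.2 -> env t o.1 = Some c ->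
  site t c = Some o.
Proof.
case=> //= {}s x X d _ [-> ->]; rewrite eqxx => -[->]; rewrite eqxx.
by case: o.
Qed.

(* [sites] collects the allocation sites at the end of the run; since sites
   never change, any two entries of the trace can be compared through it. *)
Lemma run_points_to_inv s e : runs_from P L s e ->
  points_to_inv (full_points_to P L) s ->
  exists sites : nat -> option obj,
    (forall c o, site s c = Some o -> sites c = Some o) /\
    forall st t, List.In (st, t) e ->
      [/\ points_to_inv (full_points_to P L) t,
          forall c o, site t c = Some o -> sites c = Some o &
          forall c o, st = SAlloc o.1 o.2 -> env t o.1 = Some c ->
            sites c = Some o].
Proof.
elim: e s => [|[st1 s1] e IH] s /=; first by move=> _ _; exists (site s).
move=> [Pst ss1 run] sI.
have s1I := step_points_to_inv.1 _ _ _ ss1 (or_introl Pst) sI.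
have [sites [s1s es]] := IH _ run s1I.
exists sites; split=> [c o sc|st t [[<- <-]|/es//]].
  exact/s1s/(step_site_mono.1 _ _ _ ss1).
by split=> // c o sto so; apply/s1s/(alloc_site ss1 sto so).
Qed.

(** The invariant yields an edge from [x] to the actual site of [c]; the allocation revealing [o]
    may occur elsewhere in the run, and [sites] identifies the two. *)
Lemma detected_full mon e :
  execution P L e -> detected mon e `<=` full_points_to P L.
Proof.
move=> run [x o] [st [c [[_ [t [y [/= tin stx tc]]]] /= stx']]].
move: stx tc; rewrite stx' => -[<-] tc [_ [u [z [/= uin [<-] uc]]]].
have I0 : points_to_inv (full_points_to P L) (init V F C) by split.
have [sites [_ es]] := run_points_to_inv run I0.
have [[tI _] ts _] := es _ _ tin; have [_ _ us] := es _ _ uin.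
have [o' /ts sc xo'] := tI _ _ tc.
by move: sc xo'; rewrite (us c o) // => -[<-].
Qed.

(** * Sequences of executions *)

Lemma missing_le (H : Type) (h : nat -> H) E i j : i <= j ->
  missing P (naive H P) h E i `<=` missing P (naive H P) h E j.
Proof.
elim: j => [|j IH]; first by rewrite leqn0 => /eqP->.
rewrite leq_eqVlt => /orP[/eqP->//|/IH ij]; apply: (subset_trans ij).
by move=> p mp; left.
Qed.

Lemma missing_sub (H : Type) (h : nat -> H) E (Q : set edge) :
  (forall i, 0 < i -> detected [set st | P st /\ target st != None] (E i) `<=` Q) ->
  forall i, missing P (naive H P) h E i `<=` Q.
Proof.
by move=> EQ; elim=> [|i IH] p //= [/IH|[dp _]] //; apply: (EQ i.+1).
Qed.

(** Either the edge was in the previous result, which the new one contains, or it is a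
    counterexample and becomes a missing edge. *)
Lemma detected_result (H : Type) (h : nat -> H) E i : 0 < i ->
  detected [set st | P st /\ target st != None] (E i) `<=`
    result P (naive H P) h E i.
Proof.
case: i => // i _ p dp.
have [pi|npi] := pselect (points_to P (missing P (naive H P) h E i) p).
  by apply: points_toS pi => // q mq; apply/pt_miss; left.
by apply/pt_miss; right.
Qed.

End NaiveAnalysis.

Theorem mainTheorem1 (V F : eqType) (C M H : Type)
    (VP : set V) (P : set (stmt V F C M)) (L : library V F C M) :
  finite_set VP -> finite_set P -> program_over VP P ->
  library_apart VP L -> no_library_alloc L -> disjoint_fields P L ->
  (forall h : nat -> H,
     eventually_sound VP P L (result P (naive H P) h) /\
     precise P L (result P (naive H P) h)) /\
  automatic P (naive H P).
Proof.
move=> finVP finP overP apart noalloc _; split; last first.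
  move=> h h' E i _; congr (points_to P _).
  by elim: i => //= i ->.
move=> h; split=> E execE; last first.
  move=> i _; apply: points_toS => [st Pst ncall|]; first by left; split=> //; left.
  by apply: missing_sub => j j0; apply/detected_full/execE.
split=> [i j /andP[j0 ji] p occ|].
  (* Result [j] covers run [j]; missing sets only grow, so result [i] covers it too. *)
  have /(detected_result h j0) : detected [set st | P st /\ target st != None] (E j) p.
    exact: (sound_detected apart noalloc (execE _ j0)).
  by apply: points_toS => // q mq; apply/pt_miss/(missing_le ji).
(* [N] exists once the values form a finite set; they are subsets of [VP] times the allocations of
   [P]. *)
apply/finite_set_leP/sub_finite_set; last first.
  apply/finite_powerset/(finite_setX finVP).
  (* Objects map injectively to allocation statements, so finiteness of [P] passes to them. *)
  apply: (finite_preimage _ finP (f := fun o : obj V C => SAlloc o.1 o.2)).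
  by move=> [x X] [y Y] _ _ [-> ->].
move=> _ [i _ <-]; apply: points_to_range => //.
by apply: missing_sub => j _; apply: detected_range.
Qed.
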